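(* Let $k$ be a positive integer. If $G$ is a $\delta(G)$-regular finite simple graph, then $$d_R^k(G)\le \max\{2k-1,\ \delta(G)+k\}\le \delta(G)+2k-1.$$
   Context: Let $k\ge1$ be an integer. A Roman $k$-dominating function (RkDF) on a graph $G$ is a map $f:V(G)\to\{0,1,2\}$ such that every vertex $v$ with $f(v)=0$ has at least $k$ neighbors $u$ with $f(u)=2$. A set $\{f_1,\ldots,f_d\}$ of pairwise distinct RkDFs on $G$ with $\sum_{i=1}^d f_i(v)\le 2k$ for every $v\in V(G)$ is a Roman $(k,k)$-dominating family on $G$; the maximum number of functions in such a family is the Roman $(k,k)$-domatic number $d_R^k(G)$. *)

(* Defs.v *)
From mathcomp Require Import all_boot.

Set Implicit Arguments.
Unset Strict Implicit.
Unset Printing Implicit Defensive.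

(* A finite simple graph is a symmetric irreflexive relation [e] on a finite
   type [T] of vertices. *)
Section Defs.
Variables (T : finType) (e : rel T).

Definition simple_graph : Prop := symmetric e /\ irreflexive e.

Definition neighbors (v : T) : {set T} := [set u | e v u].

Definition degree (v : T) : nat := #|neighbors v|.

(* In an irreflexive graph every degree is less than #|T|, so the default value
   #|T| matters only for the graph without vertices, where it is 0. *)
Definition min_degree : nat := \big[minn/#|T|]_(v : T) degree v.

Definition regular (r : nat) : Prop := forall v : T, degree v = r.

Definition roman_dom (k : nat) (f : {ffun T -> 'I_3}) : bool :=
  [forall v, (f v == 0 :> nat) ==>
             (k <= #|[set u in neighbors v | f u == 2 :> nat]|)].

Definition roman_family (k : nat) (F : {set {ffun T -> 'I_3}}) : bool :=
  [forall f in F, roman_dom k f] && [forall v, \sum_(f in F) f v <= 2 * k].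

(* For k > 0 the constant function 1 is a one-element family, so the empty
   family does not affect this maximum. *)
Definition roman_domatic (k : nat) : nat :=
  \max_(F : {set {ffun T -> 'I_3}} | roman_family k F) #|F|.

End Defs.

(* Main.v *)
(** Let [r] be the degree and [n] the order of the graph.  If [r < k], no
    function of the family takes the value 0, so a family with at least [2 k]
    members contains only the constant function 1, which is absurd.  If
    [k <= r], counting the edges between the zeros and the twos of a Roman
    k-dominating function [f] gives [k |V0| <= r |V2|], whence the weight of [f]
    is at least [2 k n / (r + k)]; the weights in a family sum to at most
    [2 k n]. *)

Require Import Defs.
From mathcomp Require Import all_boot zify.

Section RomanDomination.
Variables (T : finType) (e : rel T) (k : nat).
Implicit Types (f : {ffun T -> 'I_3}) (F : {set {ffun T -> 'I_3}}).

Lemma roman_dom_zeros_twos (r : nat) f :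
    symmetric e -> regular e r -> roman_dom e k f ->
  k * #|[set v | f v == 0 :> nat]| <= r * #|[set u | f u == 2 :> nat]|.
Proof.
move=> e_sym e_reg /forallP f_dom; rewrite ![_ * #|_|]mulnC -!sum_nat_const.
pose between (v u : T) := e v u && (f u == 2 :> nat).
apply: (@leq_trans (\sum_(v in [set v | f v == 0 :> nat]) \sum_u between v u)).
  apply: leq_sum => v; rewrite inE => fv0.
  apply: leq_trans (implyP (f_dom v) fv0) _.
  rewrite -sum1_card big_mkcond /=; apply: leq_sum => u _.
  by rewrite !inE /between; case: (_ && _).
(* Summed over [u] first: a vertex of value 2 is counted at most once per neighbor, so at most [r]
   times; any other [u] contributes nothing. *)
rewrite exchange_big /= [X in _ <= X]big_mkcond; apply: leq_sum => u _.
rewrite inE /between; case: ifP => _; last by rewrite big1 // => v; rewrite andbF.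
rewrite -(e_reg u) /degree -sum1_card big_mkcond [X in _ <= X]big_mkcond /=.
apply: leq_sum => v _; rewrite !inE andbT e_sym.
by case: ifP; case: (e u v).
Qed.

(** Holds vertex by vertex: [f v + [f v = 0] = 1 + [f v = 2]] for each of the three values. *)
Lemma weight_zeros_twos f :
  \sum_v f v + #|[set v | f v == 0 :> nat]| =
  #|T| + #|[set v | f v == 2 :> nat]|.
Proof.
rewrite -cardsT -!sum1_card !(big_mkcond (fun _ => _ \in _)) -!big_split /=.
by apply: eq_bigr => v _; rewrite !inE; case: (f v) => [[|[|[|]]]].
Qed.

Lemma card_zeros_twos f :
  #|[set v | f v == 0 :> nat]| + #|[set v | f v == 2 :> nat]| <= #|T|.
Proof.
rewrite -cardsUI -[X in _ <= X]addn0 leq_add ?max_card // leqn0 cards_eq0.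
by apply/eqP/setP=> v; rewrite !inE; case: (f v) => [[|[|[|]]]].
Qed.

Lemma roman_dom_weight (r : nat) f :
    symmetric e -> regular e r -> k <= r -> roman_dom e k f ->
  2 * k * #|T| <= (r + k) * \sum_v f v.
Proof.
move=> e_sym e_reg k_le_r /(roman_dom_zeros_twos _ _ e_sym e_reg).
have := weight_zeros_twos f; have := card_zeros_twos f.
(* With weight [n + |V2| - |V0|], the difference of the two sides is
   [(r - k) n + (r + k) (|V2| - |V0|)]. Since [k <= r] and [n >= |V0| + |V2|], it is at least
   [2 (r |V2| - k |V0|) >= 0]. *)
move: #|_| #|_| #|_| (\sum_v f v) => a b n w; nia.
Qed.

Lemma roman_family_weight F :
  roman_family e k F -> \sum_(f in F) \sum_v f v <= 2 * k * #|T|.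
Proof.
case/andP=> _ /forallP F_le; rewrite exchange_big mulnC -sum_nat_const.
exact: leq_sum.
Qed.

Lemma card_roman_family_large_degree (r : nat) F :
    symmetric e -> regular e r -> 0 < k <= r -> 0 < #|T| ->
  roman_family e k F -> #|F| <= r + k.
Proof.
move=> e_sym e_reg /andP[k_gt0 k_le_r] n_gt0 famF.
have F_dom f : f \in F -> roman_dom e k f.
  by case/andP: famF => /forallP F_dom _; apply/implyP: (F_dom f).
have /(leq_mul (leqnn (r + k))) := roman_family_weight _ famF.
rewrite big_distrr /= => sum_le.
have sum_ge : #|F| * (2 * k * #|T|) <= \sum_(f in F) (r + k) * \sum_v f v.
  rewrite -sum_nat_const; apply: leq_sum => f fF.
  by apply: roman_dom_weight => //; apply: F_dom.
have pos : 0 < 2 * k * #|T| by rewrite !muln_gt0 k_gt0 n_gt0.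
by rewrite -(leq_pmul2r pos) (leq_trans sum_ge).
Qed.

Lemma roman_dom_small_degree (r : nat) f v :
  regular e r -> r < k -> roman_dom e k f -> 0 < f v.
Proof.
move=> e_reg r_lt_k /forallP/(_ v)/implyP f_dom; rewrite lt0n.
apply/negP=> /f_dom; apply/negP; rewrite -ltnNge (leq_ltn_trans _ r_lt_k) //.
rewrite -(e_reg v); apply: subset_leq_card.
by apply/subsetP=> u; rewrite !inE => /andP[].
Qed.

Lemma card_roman_family_small_degree (r : nat) F :
    regular e r -> r < k -> roman_family e k F -> #|F| <= 2 * k - 1.
Proof.
move=> e_reg r_lt_k /andP[/forallP F_dom /forallP F_le].
have F_gt0 f v : f \in F -> 0 < f v.
  by move=> fF; apply: roman_dom_small_degree e_reg r_lt_k (implyP (F_dom f) fF).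
have [F_small|F_large] := leqP #|F| (2 * k - 1); first by [].
(* With at least [2 k] members, all positive at [v], those other than [f] already sum to at least
   [2 k - 1] there, which leaves at most 1 for [f v]. *)
have F_one f v : f \in F -> f v = 1 :> nat.
  move=> fF; have := F_le v; rewrite (bigD1 f fF) /=.
  have : #|F| <= (\sum_(g in F | g != f) g v).+1.
    rewrite (cardsD1 f) fF add1n ltnS -sum1_card.
    rewrite [X in _ <= X](eq_bigl (fun g => g \in F :\ f)); last first.
      by move=> g; rewrite !inE andbC.
    by apply: leq_sum => g /setD1P[_ gF]; apply: F_gt0.
  have := F_gt0 f v fF; move: F_large; clear.
  move: #|F| (\sum_(_ in _ | _) _) (nat_of_ord _) => d s x; lia.
(* Here [k] is positive because [r < k], so [1 <= 2 k - 1]. *)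
suff : #|F| <= 1 by lia.
apply/card_le1_eqP=> f g fF gF; apply/ffunP=> v; apply: val_inj.
by rewrite /= !F_one.
Qed.

End RomanDomination.

Theorem theorem6 (T : finType) (e : rel T) (k : nat)
  (graph_e : simple_graph e) (k_gt0 : 0 < k)
  (reg_e : regular e (min_degree e)) :
  roman_domatic e k <= maxn (2 * k - 1) (min_degree e + k)
                    <= min_degree e + 2 * k - 1.
Proof.
(* The second inequality rests on [k >= 1], which gives [k <= 2 k - 1]. *)
have [e_sym _] := graph_e; apply/andP; split; last by lia.
apply/bigmax_leqP=> F famF; rewrite leq_max.
have [r_lt_k|k_le_r] := ltnP (min_degree e) k.
  by rewrite (card_roman_family_small_degree _ _ _ _ _ reg_e r_lt_k famF).
(* Without vertices [min_degree e] takes its default value [#|T| = 0], and [k <= 0] contradicts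
   [k_gt0]. *)
have [n0|n_gt0] := posnP #|T|.
  by move: k_le_r; rewrite /min_degree big_pred0 ?n0; [lia | exact: card0_eq].
apply/orP; right; apply: card_roman_family_large_degree famF => //.
by rewrite k_gt0.
Qed.
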